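(* Let $T\in(0,\infty)$, $\theta\in\mathcal P_T$, let $(\Omega,\mathcal F,\mathbb P)$ be a probability space, and let $(E,\|\cdot\|_E)$ be a Banach space. Write $\mathcal L^p=\mathcal L^p(\mathbb P;\|\cdot\|_E)$. Then: (i) for all $p\in[1,\infty)$, $\beta\in[0,1]$, $\gamma\in[\beta,1]$ and all $(\mathcal F,\|\cdot\|_E)$-strongly measurable stochastic processes $X,Y\colon[0,T]\times\Omega\to E$ it holds that $$\|X-[Y]_\theta\|_{\mathcal C^\beta([0,T],\|\cdot\|_{\mathcal L^p})}\le\Bigl[\tfrac{2|d_{\max}(\theta)|^{1-\beta}}{d_{\min}(\theta)}+1\Bigr]\sup_{t\in\theta}\|X_t-Y_t\|_{\mathcal L^p}+\bigl[2|d_{\max}(\theta)|^{-\beta}+2^{-\gamma}\bigr]|d_{\max}(\theta)|^\gamma\,|X|_{\mathcal C^\gamma([0,T],\|\cdot\|_{\mathcal L^p})};$$ (ii) for all $p\in(1,\infty)$, $\beta\in(\frac1p,1]$, $\alpha\in[0,\beta-\frac1p)$, $\gamma\in[\beta,1]$ and all $(\mathcal F,\|\cdot\|_E)$-strongly measurable stochastic processes $X,Y\colon[0,T]\times\Omega\to E$ with continuous sample paths it holds that $$\begin{aligned}\Bigl(\mathbb E\bigl[\|X-[Y]_\theta\|^p_{\mathcal C^\alpha([0,T],\|\cdot\|_E)}\bigr]\Bigr)^{1/p}\le\ &\Xi_{T,p,\alpha,\beta}\Bigl(\Bigl[\tfrac{2|d_{\max}(\theta)|^{1-\beta}}{d_{\min}(\theta)}+1\Bigr]\sup_{t\in\theta}\|X_t-Y_t\|_{\mathcal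 L^p}\\&+\bigl[2|d_{\max}(\theta)|^{-\beta}+2^{-\gamma}\bigr]|d_{\max}(\theta)|^\gamma\,|X|_{\mathcal C^\gamma([0,T],\|\cdot\|_{\mathcal L^p})}\Bigr).\end{aligned}$$
   Context: $\mathcal P_T$ is the set of all finite sets $\theta\subseteq[0,T]$ with $\{0,T\}\subseteq\theta$. For $\theta=\{\theta_0<\theta_1<\dots<\theta_n\}\in\mathcal P_T$, $d_{\max}(\theta)=\max_{j\in\{1,\dots,n\}}|\theta_j-\theta_{j-1}|$ and $d_{\min}(\theta)=\min_{j\in\{1,\dots,n\}}|\theta_j-\theta_{j-1}|$. For $f\colon[0,T]\to E$, $[f]_\theta\colon[0,T]\to E$ is the piecewise affine linear interpolation: for $j\in\{1,\dots,n\}$, $s\in[\theta_{j-1},\theta_j]$, $[f]_\theta(s)=\frac{(\theta_j-s)f(\theta_{j-1})}{\theta_j-\theta_{j-1}}+\frac{(s-\theta_{j-1})f(\theta_j)}{\theta_j-\theta_{j-1}}$; for a process it is applied to each sample path. A stochastic process $X\colon[0,T]\times\Omega\to E$ is $(\mathcal F,\|\cdot\|_E)$-strongly measurable if each $X_t\colon\Omega\to E$ is strongly measurable. For a strongly measurable $Z\colon\Omega\to E$, $\|Z\|_{\mathcal L^p(\mathbb P;\|\cdot\|_E)}=(\mathbb E[\|Z\|_E^p])^{1/p}\in[0,\infty]$. For a vector space $V$ with a seminorm $\|\cdot\|$ which may take the value $\infty$, $r\in[0,1]$ and $f\colon[0,T]\to V$: $|f|_{\mathcal C^r([0,T],\|\cdot\|)}=\sup_{s\neq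 t}\|f(t)-f(s)\|/|t-s|^r\in[0,\infty]$ and $\|f\|_{\mathcal C^r([0,T],\|\cdot\|)}=\sup_t\|f(t)\|+|f|_{\mathcal C^r([0,T],\|\cdot\|)}$. For $\|\cdot\|=\|\cdot\|_{\mathcal L^p}$ a process is regarded as the function $t\mapsto X_t$ with values in strongly measurable functions; for $\|\cdot\|=\|\cdot\|_E$ the norm is applied to each sample path. $\Xi=(\Xi_{T,p,\alpha,\beta})_{T,p,\alpha,\beta\in\mathbb R}\colon\mathbb R^4\to\mathbb R$ is a fixed function with the following property (such a function exists by the Kolmogorov-Chentsov continuity theorem): for every $T\in[0,\infty)$, $p\in(1,\infty)$, $\beta\in(\frac1p,1]$, every Banach space $(E,\|\cdot\|_E)$, every probability space $(\Omega,\mathcal F,\mathbb P)$, and every strongly measurable process $X$ with $\|X\|_{\mathcal C^\beta([0,T],\|\cdot\|_{\mathcal L^p(\mathbb P;\|\cdot\|_E)})}<\infty$ there exists an $(\mathcal F,\|\cdot\|_E)$-strongly measurable process $Y\colon[0,T]\times\Omega\to E$ with continuous sample paths such that $\mathbb P(X_t=Y_t)=1$ for all $t\in[0,T]$ and such that for every $\alpha\in[0,\beta-\frac1p)$, $(\mathbb E[\|Y\|^p_{\mathcal C^\alpha([0,T],\|\cdot\|_E)}])^{1/p}\le\Xi_{T,p,\alpha,\beta}\|X\|_{\mathcal C^\beta([0,T],\|\cdot\|_{\mathcal L^p(\mathbb P;\|\cdot\|_E)})}<\infty$. *)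

(* Defs.v *)
From HB Require Import structures.
From mathcomp Require Import all_boot all_order all_algebra finmap.
From mathcomp Require Import all_classical all_reals all_analysis.
Import Order.TTheory GRing.Theory Num.Theory numFieldNormedType.Exports.

Set Implicit Arguments.
Unset Strict Implicit.
Unset Printing Implicit Defensive.

Local Open Scope fset_scope.
Local Open Scope classical_set_scope.
Local Open Scope ring_scope.

(* Functions on [0, T] are total functions on R of which only the values on
   [0, T] are ever used. *)

Section Partitions.
Context {R : realType}.
Implicit Types (T s : R) (theta : {fset R}) (j : nat).

Definition is_partition T theta : Prop :=
  [/\ 0 \in theta, T \in theta & forall t : R, t \in theta -> 0 <= t <= T].

(* knot theta 0 < ... < knot theta (nsteps theta) are the elements of theta in
   increasing order. *)
Definition knot theta j : R := nth 0 (sort <=%R (enum_fset theta)) j.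

Definition nsteps theta : nat := #|` theta|.-1.

Definition d_max theta : R :=
  \big[Order.max/0]_(j < nsteps theta) `|knot theta j.+1 - knot theta j|.

(* The default value d_max theta of the iterated minimum is harmless: it is at
   least every term. *)
Definition d_min theta : R :=
  \big[Order.min/d_max theta]_(j < nsteps theta)
     `|knot theta j.+1 - knot theta j|.

(* The interval used at s is [knot j, knot j.+1] for the least j such that
   s <= knot j.+1; by lin_interpE below, any interval containing s would do. *)
Definition lin_interp (V : lmodType R) theta (f : R -> V) (s : R) : V :=
  let j := find (fun x => s <= x) (behead (sort <=%R (enum_fset theta))) in
  let a := knot theta j in
  let b := knot theta j.+1 in
  ((b - s) / (b - a)) *: f a + ((s - a) / (b - a)) *: f b.

Lemma knot_lt theta i j : (i < j <= nsteps theta)%N ->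
  knot theta i < knot theta j.
Proof.
rewrite /nsteps => /andP[ij jn].
have jsz : (j < size (sort <=%R (enum_fset theta)))%N.
  rewrite size_sort; apply: leq_ltn_trans (jn) _; rewrite ltn_predL.
  rewrite lt0n; apply: contraTneq (leq_trans (leq_ltn_trans (leq0n i) ij) jn).
  by move=> ->.
have srt : sorted <%R (sort <=%R (enum_fset theta)).
  by rewrite sort_lt_sorted fset_uniq.
exact: (sorted_ltn_nth lt_trans 0 srt i j (ltn_trans ij jsz) jsz ij).
Qed.

Lemma lin_interpE (V : lmodType R) theta (f : R -> V) s j :
  (j < nsteps theta)%N -> knot theta j <= s <= knot theta j.+1 ->
  lin_interp theta f s =
    ((knot theta j.+1 - s) / (knot theta j.+1 - knot theta j)) *:
      f (knot theta j) +
    ((s - knot theta j) / (knot theta j.+1 - knot theta j)) *: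
      f (knot theta j.+1).
Proof.
move=> jn /andP[js sj]; rewrite /lin_interp.
set l := behead _; set k := find _ l.
have lE i : nth 0 l i = knot theta i.+1 by rewrite /l nth_behead.
have szl : size l = nsteps theta by rewrite /l size_behead size_sort.
have kj : (k <= j)%N.
  rewrite leqNgt; apply/negP => /(before_find 0) /=.
  by rewrite lE sj.
have hk : has (fun x => s <= x) l by rewrite has_find szl (leq_ltn_trans kj jn).
have sk : s <= knot theta k.+1 by rewrite -lE (nth_find 0 hk).
move: kj; rewrite leq_eqVlt => /predU1P[-> //|kj].
have kj1 : k.+1 = j.
  apply/eqP; rewrite eqn_leq kj /= leqNgt; apply/negP => lt.
  have /knot_lt : (k.+1 < j <= nsteps theta)%N by rewrite lt ltnW.
  by move=> /(le_lt_trans sk) /lt_le_trans /(_ js); rewrite ltxx.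
have sE : s = knot theta j by apply/eqP; rewrite eq_le js -kj1 sk.
have akb : knot theta k < knot theta j by apply: knot_lt; rewrite kj ltnW.
have jj1 : knot theta j < knot theta j.+1 by apply: knot_lt; rewrite ltnSn jn.
rewrite kj1 sE !subrr !mul0r !scale0r add0r addr0.
by rewrite !divff ?scale1r // subr_eq0 ?(gt_eqF akb) ?(gt_eqF jj1).
Qed.

End Partitions.

Section HolderNorms.
Context {R : realType}.
Local Open Scope ereal_scope.

(* Supremum in [0, +oo]; adjoining 0 gives the empty set supremum 0 rather than
   -oo. *)
Definition nneg_sup (A : set (\bar R)) : \bar R := ereal_sup (0 |` A).

Definition holder_seminorm (V : lmodType R) (N : V -> \bar R) (r T : R)
    (f : R -> V) : \bar R :=
  nneg_sup [set x | exists s t : R,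
    [/\ (0 <= s <= T)%R, (0 <= t <= T)%R, s != t &
        x = N (f t - f s)%R / (`|t - s| `^ r)%:E]].

Definition holder_norm (V : lmodType R) (N : V -> \bar R) (r T : R)
    (f : R -> V) : \bar R :=
  nneg_sup [set N (f t) | t in `[0%R, T]] + holder_seminorm N r T f.

Definition enorm (E : normedModType R) (x : E) : \bar R := `|x|%:E.

Arguments enorm {E} x.

Definition Lp_norm d (Omega : measurableType d) (P : probability Omega R)
    (E : normedModType R) (p : R) (Z : Omega -> E) : \bar R :=
  'N[P]_p%:E [enorm \o Z].

End HolderNorms.

Arguments enorm {R E} x.

Section Processes.
Context {R : realType} d (Omega : measurableType d) (E : normedModType R).
Implicit Types (X : R -> Omega -> E) (T : R).

Definition simple (Z : Omega -> E) : Prop :=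
  finite_set (range Z) /\ forall x : E, measurable (Z @^-1` [set x]).

Definition strongly_measurable (Z : Omega -> E) : Prop :=
  exists Zn : nat -> Omega -> E,
    (forall n, simple (Zn n)) /\
    forall w, Zn n w @[n --> \oo] --> Z w.

Definition strongly_measurable_process T X : Prop :=
  forall t : R, 0 <= t <= T -> strongly_measurable (X t).

Definition continuous_paths T X : Prop :=
  forall w, {within `[0, T], continuous (fun t => X t w)}.

(* The process [X]_theta, where X is interpolated path by path. *)
Definition path_interp (theta : {fset R}) X : R -> Omega -> E :=
  fun t w => lin_interp theta (fun s => X s w) t.

End Processes.

(* The defining property of the constants Xi T p alpha beta of the
   Kolmogorov-Chentsov theorem. *)
Definition kolmogorov_chentsov_constant (R : realType)
    (Xi : R -> R -> R -> R -> R) : Prop :=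
  forall (T p beta : R), 0 <= T -> 1 < p -> p^-1 < beta <= 1 ->
  forall (E : completeNormedModType R)
         (d : measure_display) (Omega : measurableType d)
         (P : probability Omega R) (X : R -> Omega -> E),
    strongly_measurable_process T X ->
    (holder_norm (Lp_norm P p) beta T X < +oo)%E ->
  exists Y : R -> Omega -> E,
    [/\ strongly_measurable_process T Y,
        continuous_paths T Y,
        forall t : R, 0 <= t <= T -> P [set w | X t w = Y t w] = 1%E &
        forall alpha : R, 0 <= alpha < beta - p^-1 ->
          ('N[P]_p%:E [(fun w => holder_norm enorm alpha T (Y ^~ w))]
             <= (Xi T p alpha beta)%:E * holder_norm (Lp_norm P p) beta T X)%E
          /\ ((Xi T p alpha beta)%:E * holder_norm (Lp_norm P p) beta T X
                < +oo)%E].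

(* Main.v *)
(** The error splits as X - [Y] = (X - [X]) + [X - Y], where [.] is
    interpolation in theta. Part (i) holds for every seminorm: [X - Y] is a
    convex combination of two values at knots and is Lipschitz with constant
    2 S / d_min, S being the largest of its values at knots; concavity of
    x^gamma shows that interpolation does not increase the gamma-Hoelder
    constant H of X, so X - [X] is gamma-Hoelder with constant 2 H, and that
    X - [X] is at most 2^-gamma d_max^gamma H. Increments over distances at
    most d_max are bounded by the Hoelder and Lipschitz constants, increments
    over larger distances by twice the supremum. For (ii), Z = X - [Y] has
    continuous paths, hence is indistinguishable from the modification provided
    by the Kolmogorov-Chentsov property. *)

Require Import Defs.
From HB Require Import structures.
From mathcomp Require Import all_boot all_order all_algebra finmap.
From mathcomp Require Import all_classical all_reals all_analysis.
From mathcomp Require Import measurable_realfun lra ring.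
Import Order.TTheory GRing.Theory Num.Theory numFieldNormedType.Exports.

Set Implicit Arguments.
Unset Strict Implicit.
Unset Printing Implicit Defensive.

Local Open Scope fset_scope.
Local Open Scope classical_set_scope.
Local Open Scope ring_scope.

(** * Concavity of powers with exponent in [0, 1] *)

Section Concavity.
Context {R : realType}.
Implicit Types a x y : R.

(** For [a > 0] this is convexity of the power 1/a at the points x^a and y^a, followed by raising to
    the power [a]. For [a = 0] both sides are 1. *)
Lemma concave_powR a l x y : 0 <= a <= 1 -> 0 <= l <= 1 -> 0 <= x -> 0 <= y ->
  (1 - l) * x `^ a + l * y `^ a <= ((1 - l) * x + l * y) `^ a.
Proof.
move=> /andP[a0 a1] /andP[l0 l1] x0 y0.
have [->|an0] := eqVneq a 0; first by rewrite !powRr0; lra.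
have agt0 : 0 < a by rewrite lt_neqAle eq_sym an0.
have p1 : 1 <= a^-1 by rewrite invf_ge1.
have u0 := powR_ge0 x a; have v0 := powR_ge0 y a.
have l01 : (0 <= l :> R) && (l <= 1) by rewrite l0.
have := @convex_powR R _ p1 (Itv01 l0 l1) (y `^ a) (x `^ a).
rewrite !inE /= !in_itv /= !andbT => /(_ v0 u0).
rewrite !convRE /= -!powRrM !divff // !powRr1 // /unstable.onem => h.
have z0 : 0 <= (1 - l) * x `^ a + l * y `^ a.
  by rewrite addr_ge0 // mulr_ge0 // subr_ge0.
rewrite -[leLHS](@powRr1 R) // -[X in _ `^ X <= _](mulVf an0) powRrM.
rewrite ge0_ler_powR ?nnegrE ?powR_ge0 //.
  by rewrite addr_ge0 // mulr_ge0 // subr_ge0.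
by rewrite addrC [leRHS]addrC.
Qed.
End Concavity.

(** * Knots of a partition and its mesh sizes *)

Section Knots.
Context {R : realType} {T : R} {theta : {fset R}}.
Hypotheses (T0 : 0 < T) (hth : is_partition T theta).

Lemma size_knots : size (sort <=%R (enum_fset theta)) = (nsteps theta).+1.
Proof.
rewrite size_sort /nsteps prednK // cardfs_gt0.
by apply/fset0Pn; exists 0; case: hth.
Qed.

Lemma knot_mem j : (j <= nsteps theta)%N -> knot theta j \in theta.
Proof.
move=> jn; suff : knot theta j \in sort <=%R (enum_fset theta).
  by rewrite mem_sort.
by rewrite mem_nth // size_knots.
Qed.

Lemma mem_knot t : t \in theta ->
  exists2 j, (j <= nsteps theta)%N & t = knot theta j.
Proof.
move=> tth; have tl : t \in sort <=%R (enum_fset theta) by rewrite mem_sort.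
exists (index t (sort <=%R (enum_fset theta))); last by rewrite /knot nth_index.
by rewrite -ltnS -size_knots index_mem.
Qed.

Lemma knot_le i j : (i <= j <= nsteps theta)%N -> knot theta i <= knot theta j.
Proof.
move=> /andP[]; rewrite leq_eqVlt => /predU1P[->//|ij jn].
by rewrite ltW // knot_lt // ij.
Qed.

Lemma knot_bounds j : (j <= nsteps theta)%N -> 0 <= knot theta j <= T.
Proof. by move=> /knot_mem; case: hth => _ _; apply. Qed.

Lemma knot_first : knot theta 0 = 0.
Proof.
case: hth => /mem_knot[j jn j0] _ _; apply/eqP; rewrite eq_le.
by rewrite {1}j0 knot_le //=; case/andP: (knot_bounds (leq0n _)).
Qed.

Lemma knot_last : knot theta (nsteps theta) = T.
Proof.
case: hth => _ /mem_knot[j jn jT] _; apply/eqP; rewrite eq_le.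
rewrite {2}jT knot_le ?jn //= andbT.
by case/andP: (knot_bounds (leqnn _)).
Qed.

Lemma nsteps_gt0 : (0 < nsteps theta)%N.
Proof.
rewrite lt0n; apply: contraTneq T0 => n0.
by rewrite -knot_last n0 knot_first ltxx.
Qed.

Lemma knot_locate s : 0 <= s <= T ->
  exists2 j, (j < nsteps theta)%N & knot theta j <= s <= knot theta j.+1.
Proof.
move=> /andP[s0 sT].
have ex : exists j, s <= knot theta j.+1.
  by exists (nsteps theta).-1; rewrite prednK ?nsteps_gt0 // knot_last.
case: (ex_minnP ex) => j sj jmin; exists j.
  rewrite -(prednK nsteps_gt0) ltnS; apply: jmin.
  by rewrite prednK ?nsteps_gt0 // knot_last.
(* Minimality of [j] rules out [s < knot theta j]; for [j = 0] that knot is 0. *)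
rewrite sj andbT; case: j jmin {sj} => [|j] jmin; first by rewrite knot_first.
by rewrite leNgt; apply/negP => /ltW /jmin; rewrite ltnn.
Qed.

Lemma knot_step_le_d_max j : (j < nsteps theta)%N ->
  knot theta j.+1 - knot theta j <= d_max theta.
Proof.
move=> jn; apply: le_trans (ler_norm _) _.
pose step (i : 'I_(nsteps theta)) := `|knot theta i.+1 - knot theta i|.
exact: (le_bigmax _ step (Ordinal jn)).
Qed.

Lemma d_min_le_knot_step j : (j < nsteps theta)%N ->
  d_min theta <= knot theta j.+1 - knot theta j.
Proof.
move=> jn; rewrite -[leRHS]ger0_norm; last first.
  by rewrite subr_ge0 knot_le // leqnSn.
pose step (i : 'I_(nsteps theta)) := `|knot theta i.+1 - knot theta i|.
exact: (bigmin_le _ (Ordinal jn) step).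
Qed.

Lemma d_max_gt0 : 0 < d_max theta.
Proof.
apply: lt_le_trans (knot_step_le_d_max nsteps_gt0).
by rewrite subr_gt0 knot_lt // ltn0Sn nsteps_gt0.
Qed.

Lemma d_min_gt0 : 0 < d_min theta.
Proof.
(* The default [d_max theta] of the iterated minimum must be positive as well. *)
apply/bigmin_gtP; split; first exact: d_max_gt0.
by move=> j _; rewrite normr_gt0 subr_eq0 gt_eqF // knot_lt // ltnSn /=.
Qed.

Lemma d_min_le_d_max : d_min theta <= d_max theta.
Proof.
exact: le_trans (d_min_le_knot_step nsteps_gt0) (knot_step_le_d_max nsteps_gt0).
Qed.

(** Between two distinct knots lies at least one whole step of the partition. *)
Lemma d_min_le_dist u v : u \in theta -> v \in theta -> u != v ->
  d_min theta <= `|u - v|.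
Proof.
have H i j : (i < j <= nsteps theta)%N ->
    d_min theta <= `|knot theta j - knot theta i|.
  move=> /andP[ij jn]; apply: le_trans (d_min_le_knot_step (leq_trans ij jn)) _.
  apply: le_trans (ler_norm _); rewrite lerD2r.
  by rewrite knot_le // ij.
move=> /mem_knot[i i_n ->] /mem_knot[j jn ->].
case: (ltngtP i j) => [ij|ji|->]; last by rewrite eqxx.
  by move=> _; rewrite distrC H // ij.
by move=> _; rewrite H // ji.
Qed.

(** The weight [l] depends on [s] alone, so the point [s] and the interpolants of all functions,
    with values in any module, share the same weights. *)
Lemma lin_interp_convex s : 0 <= s <= T -> exists j l,
  [/\ (j < nsteps theta)%N, 0 <= l <= 1,
      s = (1 - l) * knot theta j + l * knot theta j.+1 &
      forall (V : lmodType R) (f : R -> V), lin_interp theta f s =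
        (1 - l) *: f (knot theta j) + l *: f (knot theta j.+1)].
Proof.
move=> /knot_locate[j jn js]; have /andP[h1 h2] := js.
set a := knot theta j in h1 *; set b := knot theta j.+1 in h2 *.
have ab : 0 < b - a by rewrite subr_gt0 knot_lt // ltnSn.
have lE : 1 - (s - a) / (b - a) = (b - s) / (b - a).
  by rewrite -{1}(divff (lt0r_neq0 ab)) -mulrBl; congr (_ / _); ring.
exists j, ((s - a) / (b - a)); split => //.
- apply/andP; split; first by apply: divr_ge0; [rewrite subr_ge0|exact: ltW].
  by rewrite ler_pdivrMr // mul1r lerD2r.
- rewrite lE -/a -/b; field; exact: lt0r_neq0.
- by move=> V f; rewrite (lin_interpE _ jn js) lE.
Qed.

End Knots.

(* [N] need only behave like a seminorm on [M]: the L^p norm is subadditive on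
   strongly measurable maps but not on all of [Omega -> E]. *)
Record seminorm_on {R : realType} {V : lmodType R} (M : set V)
    (N : V -> \bar R) : Prop := SeminormOn {
  seminorm_domD : forall x y, M x -> M y -> M (x + y);
  seminorm_domZ : forall a x, M x -> M (a *: x);
  seminorm_ge0 : forall x, (0 <= N x)%E;
  seminormD : forall x y, M x -> M y -> (N (x + y)%R <= N x + N y)%E;
  seminormZ : forall a x, M x -> N (a *: x) = (`|a|%:E * N x)%E }.

Lemma seminorm_enorm (R : realType) (E : normedModType R) :
  seminorm_on [set: E] (@enorm R E).
Proof.
split => //.
- by move=> x; rewrite lee_fin.
- by move=> x y _ _; rewrite -EFinD lee_fin ler_normD.
- by move=> a x _; rewrite /enorm normrZ EFinM.
Qed.

(** * Seminorm calculus and two-point convex combinations *)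

Section SeminormTheory.
Context {R : realType} {V : lmodType R} {M : set V} {N : V -> \bar R}.
Hypothesis MN : seminorm_on M N.
Implicit Types (x y z : V) (u v l : R).

Lemma seminorm_domB x y : M x -> M y -> M (x - y).
Proof.
move=> Mx My; rewrite -scaleN1r.
by apply: (seminorm_domD MN) => //; apply: (seminorm_domZ MN).
Qed.

Lemma seminorm0 x : M x -> N 0 = 0%E.
Proof. by move=> Mx; rewrite -(scale0r x) (seminormZ MN) // normr0 mul0e. Qed.

Lemma seminormN x : M x -> N (- x) = N x.
Proof. by move=> Mx; rewrite -scaleN1r (seminormZ MN) // normrN1 mul1e. Qed.

Lemma seminorm_distC x y : M x -> M y -> N (x - y) = N (y - x).
Proof. by move=> Mx My; rewrite -opprB seminormN //; apply: seminorm_domB. Qed.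

Lemma seminormD_le x y u v : M x -> M y -> (N x <= u%:E)%E -> (N y <= v%:E)%E ->
  (N (x + y)%R <= (u + v)%:E)%E.
Proof.
move=> Mx My xu yv; apply: le_trans (seminormD MN Mx My) _.
by rewrite EFinD leeD.
Qed.

Lemma seminormB_le x y u v : M x -> M y -> (N x <= u%:E)%E -> (N y <= v%:E)%E ->
  (N (x - y)%R <= (u + v)%:E)%E.
Proof.
move=> Mx My xu yv; apply: seminormD_le; rewrite ?seminormN //.
by rewrite -scaleN1r; apply: (seminorm_domZ MN).
Qed.

Lemma seminormZ_le a x u : M x -> (N x <= u%:E)%E ->
  (N (a *: x)%R <= (`|a| * u)%:E)%E.
Proof.
by move=> Mx xu; rewrite (seminormZ MN) // EFinM lee_wpmul2l // lee_fin.
Qed.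

Definition mix l x y : V := (1 - l) *: x + l *: y.

Lemma mix_dom l x y : M x -> M y -> M (mix l x y).
Proof.
by move=> Mx My; apply: (seminorm_domD MN); apply: (seminorm_domZ MN).
Qed.

Lemma mix_subl l x y z : z - mix l x y = mix l (z - x) (z - y).
Proof.
rewrite /mix !scalerBr addrACA -opprD; congr (_ - _).
by rewrite -scalerDl subrK scale1r.
Qed.

Lemma mix_subr l x y z : mix l x y - z = mix l (x - z) (y - z).
Proof.
rewrite /mix !scalerBr addrACA -opprD; congr (_ - _).
by rewrite -scalerDl subrK scale1r.
Qed.

Lemma mix_sub_mix l m x y : mix m x y - mix l x y = (m - l) *: (y - x).
Proof.
rewrite /mix opprD addrACA -!scalerBl scalerBr addrC; congr (_ + _).
by rewrite -scaleNr; congr (_ *: _); ring.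
Qed.

Lemma mix_le l x y u v : 0 <= l <= 1 -> M x -> M y ->
  (N x <= u%:E)%E -> (N y <= v%:E)%E ->
  (N (mix l x y) <= ((1 - l) * u + l * v)%:E)%E.
Proof.
move=> /andP[l0 l1] Mx My xu yv.
have l1' : 0 <= 1 - l by rewrite subr_ge0.
apply: seminormD_le; try exact: (seminorm_domZ MN).
  by rewrite -{2}(ger0_norm l1'); apply: seminormZ_le.
by rewrite -{2}(ger0_norm l0); apply: seminormZ_le.
Qed.

End SeminormTheory.

(** * Interpolation estimates in a seminorm *)

Section Interpolation.
Context {R : realType} {T : R} {theta : {fset R}}.
Hypotheses (T0 : 0 < T) (hth : is_partition T theta).
Context {V : lmodType R} {M : set V} {N : V -> \bar R}.
Hypothesis MN : seminorm_on M N.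
Implicit Types (f g : R -> V) (s t K c : R).

Lemma mem_partition_itv t : t \in theta -> 0 <= t <= T.
Proof. by case: hth => _ _; apply. Qed.

Lemma lin_interp_dom f s : (forall t, t \in theta -> M (f t)) -> 0 <= s <= T ->
  M (lin_interp theta f s).
Proof.
move=> Mf /(lin_interp_convex T0 hth)[j [l [jn l01 _ ->]]].
by apply: (mix_dom MN); apply: Mf; apply: (knot_mem hth) => //; exact: ltnW.
Qed.

Lemma lin_interpB f g s : 0 <= s <= T ->
  lin_interp theta (fun t => f t - g t) s =
  lin_interp theta f s - lin_interp theta g s.
Proof.
move=> /(lin_interp_convex T0 hth)[j [l [_ _ _ E]]].
by rewrite !E !scalerBr addrACA -opprD.
Qed.

Lemma lin_interp_le f K s : (forall t, t \in theta -> M (f t)) ->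
  (forall t, t \in theta -> (N (f t) <= K%:E)%E) -> 0 <= s <= T ->
  (N (lin_interp theta f s) <= K%:E)%E.
Proof.
move=> Mf fK /(lin_interp_convex T0 hth)[j [l [jn l01 _ ->]]].
have kj := knot_mem hth (ltnW jn); have kj1 := knot_mem hth jn.
apply: le_trans (mix_le MN l01 (Mf _ kj) (Mf _ kj1) (fK _ kj) (fK _ kj1)) _.
by rewrite lee_fin -mulrDl subrK mul1r.
Qed.

Section HolderOnKnots.
Variables (f : R -> V) (K c : R).
Hypotheses (Mf : forall t, t \in theta -> M (f t)) (K0 : 0 <= K).
Hypothesis c01 : 0 <= c <= 1.
Hypothesis fK : forall u v, u \in theta -> v \in theta ->
  (N (f v - f u)%R <= (K * `|v - u| `^ c)%:E)%E.

(** As [u] lies to the right of both knots, the distances are [u - a] and [u - b], and concavity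
    moves the averaging inside the power. *)
Lemma mix_knot_holder l a b u : 0 <= l <= 1 ->
  a \in theta -> b \in theta -> u \in theta -> a <= u -> b <= u ->
  (N (f u - mix l (f a) (f b))%R
     <= (K * (u - ((1 - l) * a + l * b)) `^ c)%:E)%E.
Proof.
move=> l01 ath bth uth au bu; rewrite mix_subl.
apply: le_trans (mix_le MN l01 _ _ (fK _ _) (fK _ _)) _ => //;
  try by apply: (seminorm_domB MN); apply: Mf.
rewrite !ger0_norm ?subr_ge0 // lee_fin.
have := concave_powR c01 l01 (x := u - a) (y := u - b).
rewrite !subr_ge0 => /(_ au bu) h.
have -> : u - ((1 - l) * a + l * b) = (1 - l) * (u - a) + l * (u - b) by ring.
by apply: le_trans (ler_wpM2l K0 h); rewrite mulrDr !(mulrCA K).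
Qed.

(** Averaging [mix_knot_holder] at [u = a'] and [u = b'] with weight [m] and using concavity once
    more keeps the constant [K]. *)
Lemma mix_mix_holder l m a b a' b' : 0 <= l <= 1 -> 0 <= m <= 1 ->
  a \in theta -> b \in theta -> a' \in theta -> b' \in theta ->
  a <= b <= a' -> a' <= b' ->
  (N (mix m (f a') (f b') - mix l (f a) (f b))%R
     <= (K * ((1 - m) * a' + m * b' - ((1 - l) * a + l * b)) `^ c)%:E)%E.
Proof.
move=> l01 m01 ath bth a'th b'th /andP[ab ba'] a'b'.
have Mz : M (mix l (f a) (f b)) by apply: (mix_dom MN); apply: Mf.
have aa' := le_trans ab ba'.
have z_le : (1 - l) * a + l * b <= b.
  by case/andP: l01 => l0 l1; nra.
rewrite mix_subr.
apply: le_trans (mix_le MN m01 _ _ (mix_knot_holder l01 _ _ _ _ _)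
  (mix_knot_holder l01 _ _ _ _ _)) _ => //;
  try (by apply: (seminorm_domB MN) => //; apply: Mf);
  try exact: le_trans a'b'.
set z := (1 - l) * a + l * b in z_le *.
have za' := le_trans z_le ba'.
have := concave_powR c01 m01 (x := a' - z) (y := b' - z).
rewrite !subr_ge0 => /(_ za' (le_trans za' a'b')) h.
have -> : (1 - m) * a' + m * b' - z = (1 - m) * (a' - z) + m * (b' - z) by ring.
rewrite lee_fin; apply: le_trans (ler_wpM2l K0 h).
by rewrite mulrDr !(mulrCA K).
Qed.

(* For [s] and [t] in different steps, [lin_interp theta f t - lin_interp theta
   f s] averages increments of [f] between knots lying in the same order as [s]
   and [t], and concavity of [x `^ c] yields the constant [K] itself. *)
Lemma lin_interp_holder s t : 0 <= s <= T -> 0 <= t <= T ->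
  (N (lin_interp theta f t - lin_interp theta f s)%R
     <= (K * `|t - s| `^ c)%:E)%E.
Proof.
wlog st : s t / s < t => [H|] s0T t0T.
  have Ms := lin_interp_dom Mf s0T; have Mt := lin_interp_dom Mf t0T.
  case: (ltgtP s t) => [st|ts|->]; first exact: H.
    by rewrite (seminorm_distC MN) // distrC; apply: H.
  by rewrite subrr (seminorm0 MN Mt) lee_fin mulr_ge0 // powR_ge0.
rewrite gtr0_norm ?subr_gt0 //.
have [i [l [i_n l01 sE ->]]] := lin_interp_convex T0 hth s0T.
have [j [m [jn m01 tE ->]]] := lin_interp_convex T0 hth t0T.
have kmem := @knot_mem _ _ _ hth; have kle := @knot_le _ theta.
case: (ltngtP i j) => [ij|ji|ij].
- rewrite tE sE; apply: (mix_mix_holder l01 m01); try exact: kmem (ltnW _).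
  + exact: kmem.
  + exact: kmem.
  + by rewrite !kle // ?leqnSn ?ij //= ltnW.
  + by rewrite kle // leqnSn.
(* The order [j < i] is impossible: [t] would be at most a knot that is itself at most [s]. *)
- suff : t <= s by rewrite leNgt st.
  have h1 : t <= knot theta j.+1.
    have := kle j j.+1; rewrite leqnSn jn => /(_ isT).
    by rewrite tE; case/andP: m01 => m0 m1; nra.
  have h2 : knot theta i <= s.
    have := kle i i.+1; rewrite leqnSn i_n => /(_ isT).
    by rewrite sE; case/andP: l01 => l0 l1; nra.
  apply: le_trans h1 (le_trans _ h2); apply: kle.
  by rewrite ji ltnW.
(* In a common step the increment is the fraction [m - l] of [f b - f a]. *)
- subst j; set a := knot theta i in sE tE *; set b := knot theta i.+1 in sE tE *.
  have ab : a < b by rewrite knot_lt // ltnSn.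
  have E : t - s = (m - l) * (b - a) by rewrite tE sE; ring.
  have lm : 0 <= m - l.
    have : 0 < (m - l) * (b - a) by rewrite -E subr_gt0.
    by rewrite pmulr_lgt0 ?subr_gt0 // => /ltW; rewrite subr_ge0.
  have lm1 : m - l <= 1 by case/andP: m01; case/andP: l01; lra.
  rewrite -/(mix m (f a) (f b)) -/(mix l (f a) (f b)) mix_sub_mix.
  have ath : a \in theta by rewrite kmem // ltnW.
  have bth : b \in theta by rewrite kmem.
  apply: le_trans (seminormZ_le MN _ _ (fK ath bth)) _.
    by apply: (seminorm_domB MN); apply: Mf.
  rewrite E ger0_norm // (gtr0_norm (x := b - a)) ?subr_gt0 //.
  rewrite lee_fin mulrCA ler_wpM2l //.
  (* Concavity between 0 and [b - a]; the term in 0^c, where 0^c is 1 if [c = 0], is nonnegative and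
     is dropped. *)
  have := @concave_powR _ c (m - l) 0 (b - a) c01.
  rewrite lm lm1 lexx subr_ge0 => /(_ isT isT (ltW ab)).
  rewrite mulr0 add0r; apply: le_trans; rewrite lerDr mulr_ge0 ?powR_ge0 //.
  by rewrite subr_ge0.
Qed.

End HolderOnKnots.

(** The case [c = 1] of [lin_interp_holder]: two values at knots differ by at most [2 * K], and
    distinct knots are at least [d_min theta] apart. *)
Lemma lin_interp_lipschitz f K s t : (forall u, u \in theta -> M (f u)) ->
  (forall u, u \in theta -> (N (f u) <= K%:E)%E) ->
  0 <= s <= T -> 0 <= t <= T ->
  (N (lin_interp theta f t - lin_interp theta f s)%R
     <= (2 * K / d_min theta * `|t - s|)%:E)%E.
Proof.
move=> Mf fK s0T t0T.
have d0 := d_min_gt0 T0 hth.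
have K0 : 0 <= K.
  case: hth => h0 _ _; rewrite -lee_fin.
  exact: le_trans (seminorm_ge0 MN _) (fK _ h0).
rewrite -[X in _ * X]powRr1 //; apply: lin_interp_holder => //.
- by apply: divr_ge0; [exact: mulr_ge0|exact: ltW].
- by rewrite ler01 lexx.
- move=> u v uth vth; rewrite powRr1 //.
have [->|uv] := eqVneq v u.
  by rewrite subrr (seminorm0 MN (Mf _ uth)) subrr normr0 mulr0.
apply: le_trans (seminormB_le MN _ _ (fK _ vth) (fK _ uth)) _; try exact: Mf.
rewrite lee_fin -mulr2n -[leLHS]mulr_natl mulrAC ler_pdivlMr //.
rewrite ler_wpM2l ?mulr_ge0 //.
by apply: (d_min_le_dist hth).
Qed.

(** The error averages [f s - f a] and [f s - f b] over the ends [a], [b] of the step containing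
    [s]. By concavity its seminorm is at most H (2 l (1 - l) (b - a))^c, and 2 l (1 - l) is at most
    1/2. *)
Lemma lin_interp_error f H c s : (forall t, 0 <= t <= T -> M (f t)) -> 0 <= H ->
  0 <= c <= 1 ->
  (forall u v, 0 <= u <= T -> 0 <= v <= T ->
     (N (f v - f u)%R <= (H * `|v - u| `^ c)%:E)%E) ->
  0 <= s <= T ->
  (N (f s - lin_interp theta f s)%R
     <= (2 `^ (- c) * d_max theta `^ c * H)%:E)%E.
Proof.
move=> Mf H0 c01 fH s0T.
have [j [l [jn l01 sE ->]]] := lin_interp_convex T0 hth s0T.
have a0T := knot_bounds hth (ltnW jn); have b0T := knot_bounds hth jn.
have ab : knot theta j < knot theta j.+1 by rewrite knot_lt // ltnSn.
have step := knot_step_le_d_max jn.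
set a := knot theta j in sE a0T ab step *.
set b := knot theta j.+1 in sE b0T ab step *.
rewrite -/(mix l _ _) mix_subl.
apply: le_trans (mix_le MN l01 _ _ (fH _ _ _ _) (fH _ _ _ _)) _ => //;
  try by apply: (seminorm_domB MN); apply: Mf.
case/andP: (l01) => l0 l1.
have saE : s - a = l * (b - a) by rewrite sE; ring.
have bsE : b - s = (1 - l) * (b - a) by rewrite sE; ring.
have ba0 : 0 <= b - a by rewrite subr_ge0 ltW.
have sa : 0 <= s - a by rewrite saE mulr_ge0.
have bs : 0 <= b - s by rewrite bsE mulr_ge0 // subr_ge0.
rewrite (distrC s b) !ger0_norm // lee_fin.
have h := concave_powR c01 l01 sa bs.
have -> : 2 `^ (- c) * d_max theta `^ c * H = H * (2^-1 * d_max theta) `^ c.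
  rewrite powRM ?(ltW (d_max_gt0 T0 hth)) // -(@powR_inv1 _ 2) // -powRrM mulN1r.
  by rewrite mulrC.
rewrite !(mulrCA _ H) -mulrDr ler_wpM2l //; apply: le_trans h _.
apply: ge0_ler_powR; rewrite ?nnegrE.
- by case/andP: c01.
- by rewrite addr_ge0 // mulr_ge0 // subr_ge0.
- by apply: mulr_ge0 => //; apply: ltW; exact: (d_max_gt0 T0 hth).
apply: (@le_trans _ _ (2^-1 * (b - a))); last by rewrite ler_wpM2l.
(* The inequality 4 l (1 - l) <= 1, source of the factor 1/2. *)
rewrite saE bsE; have : 0 <= (1 - 2 * l) ^+ 2 by exact: sqr_ge0.
have : 0 < b - a by rewrite subr_gt0.
set h' := b - a; rewrite expr2 => h0 q; nra.
Qed.

End Interpolation.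

(** * Suprema and Hoelder norms with values in [0, +oo] *)

Section HolderNormBounds.
Context {R : realType}.
Local Open Scope ereal_scope.
Implicit Types (A : set (\bar R)).

Lemma nneg_sup_ge0 A : 0 <= nneg_sup A.
Proof. by apply: ereal_sup_ubound; left. Qed.

Lemma nneg_sup_ubound A x : A x -> x <= nneg_sup A.
Proof. by move=> Ax; apply: ereal_sup_ubound; right. Qed.

Lemma nneg_sup_le A c : 0 <= c -> (forall x, A x -> x <= c) -> nneg_sup A <= c.
Proof. by move=> c0 Ac; apply: ge_ereal_sup => x [->//|]; exact: Ac. Qed.

Lemma div_powR_EFin (x : \bar R) (u r : R) : (0 < u)%R ->
  x / (u `^ r)%:E = x * ((u `^ r)^-1)%:E.
Proof. by move=> u0; rewrite inver gt_eqF // powR_gt0. Qed.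

Lemma holder_norm_ge0 (V : lmodType R) (N : V -> \bar R) (r T : R) f :
  0 <= holder_norm N r T f.
Proof. by rewrite adde_ge0 // nneg_sup_ge0. Qed.

Lemma holder_norm_le (V : lmodType R) (N : V -> \bar R) (r T a c : R) f :
  (0 <= a)%R -> (0 <= c)%R ->
  (forall t, (0 <= t <= T)%R -> N (f t) <= a%:E) ->
  (forall s t, (0 <= s <= T)%R -> (0 <= t <= T)%R -> s != t ->
     N (f t - f s)%R <= (c * `|t - s| `^ r)%:E) ->
  holder_norm N r T f <= (a + c)%:E.
Proof.
move=> a0 c0 fa fc; rewrite /holder_norm EFinD; apply: leeD.
  apply: nneg_sup_le => [|_ [t /= tT <-]]; first by rewrite lee_fin.
  by apply: fa; move: tT; rewrite in_itv.
apply: nneg_sup_le => [|_ [s [t [sT tT st ->]]]]; first by rewrite lee_fin.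
have ts0 : (0 < `|t - s|)%R by rewrite normr_gt0 subr_eq0 eq_sym.
by rewrite div_powR_EFin // lee_pdivrMr ?powR_gt0 // -EFinM fc.
Qed.

(** The pairs with [s = t], absent from the seminorm, are covered by [N 0 = 0]. *)
Lemma holder_seminorm_dist (V : lmodType R) (M : set V) (N : V -> \bar R)
    (r T H s t : R) f : seminorm_on M N -> M (f s) ->
  holder_seminorm N r T f <= H%:E -> (0 <= H)%R ->
  (0 <= s <= T)%R -> (0 <= t <= T)%R ->
  N (f t - f s)%R <= (H * `|t - s| `^ r)%:E.
Proof.
move=> MN Mf fH H0 sT tT; have [->|st] := eqVneq t s.
  by rewrite subrr (seminorm0 MN Mf) lee_fin mulr_ge0 // powR_ge0.
have ts0 : (0 < `|t - s|)%R by rewrite normr_gt0 subr_eq0.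
rewrite EFinM -lee_pdivrMr ?powR_gt0 // -div_powR_EFin //.
apply: le_trans fH; apply: nneg_sup_ubound; exists s, t; split => //.
by rewrite eq_sym.
Qed.

End HolderNormBounds.

(** * Hoelder norm of the interpolation error in an abstract seminorm *)

Section InterpolationHolderNorm.
Context {R : realType} {T : R} {theta : {fset R}}.
Hypotheses (T0 : 0 < T) (hth : is_partition T theta).
Context {V : lmodType R} {M : set V} {N : V -> \bar R}.
Hypothesis MN : seminorm_on M N.

(** At distances [r] up to the scale [D], a bound in r^c becomes one in r^b, because r^(c - b) <=
    D^(c - b). *)
Lemma powR_le_rescale (r D b c : R) : 0 < r <= D -> b <= c ->
  r `^ c <= D `^ c * (D `^ (- b) * r `^ b).
Proof.
move=> /andP[r0 rD] bc; have D0 := lt_le_trans r0 rD.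
have Dne : D != 0 by rewrite gt_eqF.
have rne : r != 0 by rewrite gt_eqF.
rewrite mulrA -powRD ?Dne ?implybT //.
rewrite -[in leLHS](subrK b c) [leLHS]powRD ?rne ?implybT //.
rewrite ler_wpM2r ?powR_ge0 //.
by apply: ge0_ler_powR; rewrite ?nnegrE ?subr_ge0 // ltW.
Qed.

(** At distances from the scale [D] on, (r / D)^b is at least 1, which turns a bound on the supremum
    into one in r^b. *)
Lemma powR_rescale_ge1 (r D b : R) : 0 < D <= r -> 0 <= b ->
  1 <= D `^ (- b) * r `^ b.
Proof.
move=> /andP[D0 Dr] b0.
rewrite powRN mulrC ler_pdivlMr ?powR_gt0 // mul1r.
by apply: ge0_ler_powR; rewrite ?nnegrE // ltW // (lt_le_trans D0 Dr).
Qed.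

(** The version with finite bounds [S] and [H]. The error is the sum of [F], the interpolation error
    of [f], and the interpolant of [h = f - g]; distances are compared with [d_max theta]. *)
Lemma lin_interp_dist (f g : R -> V) (b c S H : R) :
  (forall t, 0 <= t <= T -> M (f t)) -> (forall t, 0 <= t <= T -> M (g t)) ->
  0 <= b <= 1 -> b <= c <= 1 -> 0 <= S -> 0 <= H ->
  (forall u, u \in theta -> (N (f u - g u)%R <= S%:E)%E) ->
  (forall u v, 0 <= u <= T -> 0 <= v <= T ->
     (N (f v - f u)%R <= (H * `|v - u| `^ c)%:E)%E) ->
  (holder_norm N b T (fun t => f t - lin_interp theta g t)%R
    <= ((2 * d_max theta `^ (1 - b) / d_min theta + 1) * S
        + (2 * d_max theta `^ (- b) + 2 `^ (- c)) * d_max theta `^ c * H)%:E)%E.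
Proof.
move=> Mf Mg /andP[b0 b1] /andP[bc c1] S0 H0 fgS fH; set D := d_max theta.
have c0 := le_trans b0 bc; have c01 : 0 <= c <= 1 by rewrite c0.
have D0 : 0 < D := d_max_gt0 T0 hth; have d0 := d_min_gt0 T0 hth.
have dD : d_min theta <= D := d_min_le_d_max T0 hth.
set d := d_min theta in d0 dD *.
have memT t : t \in theta -> 0 <= t <= T := mem_partition_itv hth (t := t).
pose h t := f t - g t; pose F t := f t - lin_interp theta f t.
have Mfth t : t \in theta -> M (f t) by move=> /memT /Mf.
have Mh t : t \in theta -> M (h t).
  by move=> /memT tT; apply: (seminorm_domB MN); [exact: Mf|exact: Mg].
have ML t : 0 <= t <= T -> M (lin_interp theta h t).
  exact: (lin_interp_dom T0 hth MN Mh).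
have Mlf t : 0 <= t <= T -> M (lin_interp theta f t).
  exact: (lin_interp_dom T0 hth MN Mfth).
have MF t : 0 <= t <= T -> M (F t).
  by move=> tT; apply: (seminorm_domB MN); [exact: Mf|exact: Mlf].
have decomp t : 0 <= t <= T ->
    f t - lin_interp theta g t = F t + lin_interp theta h t.
  by move=> tT; rewrite (lin_interpB T0 hth) // /F addrA subrK.
have hS t : 0 <= t <= T -> (N (lin_interp theta h t) <= S%:E)%E.
  exact: (lin_interp_le T0 hth MN).
have FH t : 0 <= t <= T -> (N (F t) <= (2 `^ (- c) * D `^ c * H)%:E)%E.
  exact: (lin_interp_error T0 hth MN).
have Dc0 : 0 <= D `^ c := powR_ge0 _ _.
have q0 : 0 <= D `^ (- b) := powR_ge0 _ _.
have e0 : 0 <= 2 `^ (- c) :> R := powR_ge0 _ _.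
have e1 : 2 `^ (- c) <= 1 :> R.
  by rewrite powRN invf_le1 ?powR_gt0 // -[leLHS](@powRr0 R 2) ler_powR // ler1n.
have DE : D `^ (1 - b) = D * D `^ (- b).
  by rewrite powRD ?powRr1 ?(ltW D0) // (gt_eqF D0) implybT.
set q := D `^ (- b) in q0 DE *.
(* The first bracket will bound the supremum, the second one the Hoelder seminorm. *)
rewrite (_ : (_ + _)%R = (2 `^ (- c) * D `^ c * H + S) +
   (2 * q * D `^ c * H + 2 * (D * q) / d * S)); last by rewrite DE; ring.
have DcH0 : 0 <= D `^ c * H by rewrite mulr_ge0.
have DqS0 : 0 <= 2 * (D * q) / d * S.
  by rewrite mulr_ge0 // divr_ge0 ?(ltW d0) // !mulr_ge0 // ltW.
apply: holder_norm_le.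
- by rewrite addr_ge0 // -mulrA mulr_ge0.
- by rewrite addr_ge0 // -mulrA !mulr_ge0.
- by move=> t tT; rewrite decomp //; apply: (seminormD_le MN); auto.
move=> s t sT tT st; set r := `|t - s|.
have r0 : 0 < r by rewrite normr_gt0 subr_eq0 eq_sym.
rewrite !decomp // opprD addrACA mulrDl.
apply: (seminormD_le MN); try (by apply: (seminorm_domB MN); auto).
(* Increments of [F]: for [r <= D] by the Hoelder constant [2 * H], otherwise by twice the supremum
   bound, where 2^(-c) <= 1. *)
- case: (leP r D) => rD.
    apply: (@le_trans _ _ (2 * (H * r `^ c))%:E).
      have -> : F t - F s =
          (f t - f s) - (lin_interp theta f t - lin_interp theta f s).
        by rewrite !opprB addrACA [in RHS]addrACA; congr (_ + _); rewrite addrC.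
      rewrite mulr_natl mulr2n; apply: (seminormB_le MN); auto;
        try (by apply: (seminorm_domB MN); auto).
      apply: (lin_interp_holder T0 hth MN) => // u v /memT uT /memT vT.
      exact: fH.
    have := @powR_le_rescale r D b c.
    rewrite r0 rD => /(_ isT bc) /(ler_wpM2l H0).
    by rewrite lee_fin -/q; lra.
  apply: le_trans (seminormB_le MN (MF _ tT) (MF _ sT) (FH _ tT) (FH _ sT)) _.
  have : 1 <= q * r `^ b by apply: powR_rescale_ge1 => //; rewrite D0 ltW.
  move=> /(ler_wpM2l DcH0); have := ler_wpM2r DcH0 e1.
  by rewrite lee_fin; lra.
(* Increments of the interpolant of [h]: for [r <= D] by its Lipschitz constant [2 * S / d],
   otherwise by [2 * S], where [D / d >= 1] leads to the same coefficient. *)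
- have S2 : 0 <= 2 * S / d by rewrite divr_ge0 ?(ltW d0) // mulr_ge0.
  case: (leP r D) => rD.
    apply: le_trans (lin_interp_lipschitz T0 hth MN Mh fgS sT tT) _.
    rewrite -/d -/r lee_fin.
    have := @powR_le_rescale r D b 1.
    rewrite r0 rD !powRr1 ?(ltW r0) ?(ltW D0) // => /(_ isT b1).
    move=> /(ler_wpM2l S2); rewrite -/q.
    suff -> : 2 * S / d * (D * (q * r `^ b)) = 2 * (D * q) / d * S * r `^ b by [].
    by ring.
  apply: le_trans (seminormB_le MN (ML _ tT) (ML _ sT) (hS _ tT) (hS _ sT)) _.
  have h1 : 1 <= q * r `^ b by apply: powR_rescale_ge1 => //; rewrite D0 ltW.
  have h2 : 1 <= D / d by rewrite ler_pdivlMr // mul1r.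
  have h3 : 1 <= (D / d) * (q * r `^ b) by apply: mulr_ege1.
  have := ler_wpM2l S0 h3; rewrite lee_fin.
  have -> : 2 * (D * q) / d * S * r `^ b =
      2 * (S * (D / d * (q * r `^ b))) by ring.
  by lra.
Qed.

(** Both coefficients are strictly positive, so an infinite supremum or seminorm makes the right
    side [+oo]; otherwise [lin_interp_dist] applies to the finite values. *)
Lemma holder_norm_sub_lin_interp (f g : R -> V) (b c : R) :
  (forall t, 0 <= t <= T -> M (f t)) -> (forall t, 0 <= t <= T -> M (g t)) ->
  0 <= b <= 1 -> b <= c <= 1 ->
  (holder_norm N b T (fun t => f t - lin_interp theta g t)%R
    <= (2 * `|d_max theta| `^ (1 - b) / d_min theta + 1)%:E
         * nneg_sup [set N (f t - g t)%R | t in [set` theta]]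
       + ((2 * `|d_max theta| `^ (- b) + 2 `^ (- c)) * `|d_max theta| `^ c)%:E
         * holder_seminorm N c T f)%E.
Proof.
move=> Mf Mg b01 bc1; have D0 := d_max_gt0 T0 hth; have d0 := d_min_gt0 T0 hth.
rewrite (gtr0_norm D0).
set C1 := (_ + 1)%R; set C2 := (_ * _ `^ c)%R.
set S := nneg_sup _; set H := holder_seminorm _ _ _ _.
have C1_gt0 : 0 < C1.
  by rewrite ltr_wpDl // divr_ge0 ?(ltW d0) // mulr_ge0 // powR_ge0.
have C2_gt0 : 0 < C2.
  by rewrite mulr_gt0 ?powR_gt0 // addr_gt0 ?powR_gt0 // mulr_gt0 // powR_gt0.
have S0 : (0 <= S)%E := nneg_sup_ge0 _.
have H0 : (0 <= H)%E := nneg_sup_ge0 _.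
have C1S0 : (0 <= C1%:E * S)%E by rewrite mule_ge0 // lee_fin ltW.
have C2H0 : (0 <= C2%:E * H)%E by rewrite mule_ge0 // lee_fin ltW.
have [SE|Sfin] := eqVneq S +oo%E.
  rewrite SE gt0_muley ?lte_fin // addye ?leey //.
  by rewrite -ltNye; apply: lt_le_trans C2H0.
have [HE|Hfin] := eqVneq H +oo%E.
  rewrite HE gt0_muley ?lte_fin // addey ?leey //.
  by rewrite -ltNye; apply: lt_le_trans C1S0.
have SE : S = (fine S)%:E by rewrite fineK // ge0_fin_numE // ltey.
have HE : H = (fine H)%:E by rewrite fineK // ge0_fin_numE // ltey.
rewrite SE HE -!EFinM -EFinD; apply: lin_interp_dist => //.
- exact: fine_ge0.
- exact: fine_ge0.
- by move=> u uth; rewrite -SE; apply: nneg_sup_ubound; exists u.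
move=> u v uT vT; apply: (holder_seminorm_dist (T := T) MN) => //; first exact: Mf.
  by rewrite -HE.
exact: fine_ge0.
Qed.

End InterpolationHolderNorm.

(** * Strongly measurable maps *)

Section StrongMeasurability.
Context {R : realType} {d : measure_display} {Omega : measurableType d}.
Context {E : normedModType R}.
Implicit Types Z : Omega -> E.

(** The preimage is the finite union of the fibres over the values lying in [B], for any set [B]. *)
Lemma simple_preimage Z (B : set E) : simple Z -> measurable (Z @^-1` B).
Proof.
move=> [finZ mZ].
rewrite (_ : Z @^-1` B = \bigcup_(x in range Z `&` B) (Z @^-1` [set x])).
  by apply: fin_bigcup_measurable => // ; exact: finite_setIl.
apply/seteqP; split => [w Bw|w [x [_ Bx] /= ZE]]; last by rewrite /= ZE.
by exists (Z w) => //; split => //; exists w.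
Qed.

Lemma simple_op2 (op : E -> E -> E) Z1 Z2 : simple Z1 -> simple Z2 ->
  simple (fun w => op (Z1 w) (Z2 w)).
Proof.
move=> s1 s2; have [[fin1 m1] [fin2 m2]] := (s1, s2); split.
  apply: (@sub_finite_set _ _ [set op x y | x in range Z1 & y in range Z2]).
    by move=> _ [w _ <-]; exists (Z1 w); [exists w|exists (Z2 w) => //; exists w].
  exact: finite_image2.
move=> z; rewrite (_ : _ @^-1` _ = \bigcup_(x in range Z1)
    (Z1 @^-1` [set x] `&` Z2 @^-1` [set y | op x y = z])).
  apply: fin_bigcup_measurable => // x _.
  by apply: measurableI => //; exact: simple_preimage.
apply/seteqP; split => [w /= zE|w [x _ [/= ZE]]]; last by rewrite ZE.
by exists (Z1 w) => //; exists w.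
Qed.

(** The operation is applied to the approximating simple maps. Its continuity is phrased along
    filters on [nat] to match the limit rules for sums and scalar multiples. *)
Lemma strongly_measurable_op2 (op : E -> E -> E) Z1 Z2 :
  (forall (F : set_system nat) (u v : nat -> E) x y, Filter F ->
     u @ F --> x -> v @ F --> y -> op (u n) (v n) @[n --> F] --> op x y) ->
  strongly_measurable Z1 -> strongly_measurable Z2 ->
  strongly_measurable (fun w => op (Z1 w) (Z2 w)).
Proof.
move=> cop [u1 [s1 c1]] [u2 [s2 c2]].
exists (fun n w => op (u1 n w) (u2 n w)); split => [n|w].
  exact: simple_op2.
exact: cop.
Qed.

Lemma strongly_measurableD Z1 Z2 : strongly_measurable Z1 ->
  strongly_measurable Z2 -> strongly_measurable (Z1 + Z2).
Proof.
apply: (strongly_measurable_op2 (op := fun x y => x + y)) => F u v x y FF.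
exact: cvgD.
Qed.

Lemma strongly_measurableZ a Z : strongly_measurable Z ->
  strongly_measurable (a *: Z).
Proof.
move=> mZ; apply: (strongly_measurable_op2 (op := fun x _ => a *: x) _ mZ mZ).
by move=> F u v x y FF ux _; exact: cvgZr.
Qed.

Lemma strongly_measurable_cst (x : E) :
  strongly_measurable (fun _ : Omega => x).
Proof.
exists (fun _ _ => x); split => [_|w]; last exact: cvg_cst.
split; first by apply: (sub_finite_set _ (finite_set1 x)) => _ [w _ <-].
by move=> y; rewrite preimage_cst; case: ifP.
Qed.

(** Norms of the approximating simple maps are measurable and converge pointwise. *)
Lemma measurable_norm_strongly_measurable Z : strongly_measurable Z ->
  measurable_fun setT (fun w => `|Z w|).
Proof.
move=> [Zn [sZ cZ]].
apply: (@measurable_realfun.measurable_fun_cvg _ _ _ _ (fun n w => `|Zn n w|)).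
  move=> n _ B mB; rewrite setTI.
  exact: (simple_preimage (Num.norm @^-1` B) (sZ n)).
by move=> w _; apply: cvg_norm; exact: cZ.
Qed.

End StrongMeasurability.

(** * Integrals off a null set and the L^p seminorm *)

Section Lp.
Import HBNNSimple.
Context {R : realType} {d : measure_display} {Omega : measurableType d}.
Variable P : probability Omega R.
Local Open Scope ereal_scope.

(** Formulated for arbitrary nonnegative functions because it serves for pathwise Hoelder norms,
    suprema over uncountably many times. A simple function below [f], set to zero on [A], lies below
    [g] and keeps its integral. *)
Lemma le_integral_off_null (f g : Omega -> \bar R) (A : set Omega) :
  (forall w, 0 <= f w) -> (forall w, 0 <= g w) -> measurable A -> P A = 0 ->
  (forall w, ~ A w -> f w <= g w) -> \int[P]_w f w <= \int[P]_w g w.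
Proof.
move=> f0 g0 mA PA fg; rewrite !ge0_integralTE //.
apply: ge_ereal_sup => _ [h hf <-].
have mCA : measurable (~` A) by exact: measurableC.
pose k := proj_nnsfun h mCA.
have kE w : k w = if w \in ~` A then h w else 0%R by rewrite /k -mrestrict.
rewrite -integralT_nnsfun (_ : \int[P]_x (h x)%:E = \int[P]_x (k x)%:E).
  rewrite integralT_nnsfun; apply: ereal_sup_ubound; exists k => // w.
  rewrite kE; have [/set_mem nAw|_] := boolP (w \in ~` A).
    exact: le_trans (hf w) (fg w nAw).
  exact: g0.
apply: ge0_ae_eq_integral => //.
- by apply/measurable_EFinP.
- by apply/measurable_EFinP.
- by move=> w _; rewrite lee_fin.
- by move=> w _; rewrite lee_fin.
exists A; split => // w hw; apply: contrapT => nAw; apply: hw => _.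
by rewrite kE mem_set.
Qed.

Lemma le_Lnorm_off_null (p : R) (f g : Omega -> \bar R) (A : set Omega) :
  (0 <= p)%R -> measurable A -> P A = 0 ->
  (forall w, ~ A w -> `|f w| <= `|g w|) -> 'N[P]_p%:E[f] <= 'N[P]_p%:E[g].
Proof.
move=> p0 mA PA fg; rewrite unlock; apply: gt0_ler_poweR.
- by rewrite invr_ge0.
- by rewrite in_itv /= leey integral_ge0 // => w _; exact: poweR_ge0.
- by rewrite in_itv /= leey integral_ge0 // => w _; exact: poweR_ge0.
apply: (le_integral_off_null _ _ mA PA) => w; try exact: poweR_ge0.
by move=> /fg; apply: gt0_ler_poweR => //; rewrite in_itv /= leey abse_ge0.
Qed.

Lemma le_Lnorm (p : R) (f g : Omega -> \bar R) : (0 <= p)%R ->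
  (forall w, `|f w| <= `|g w|) -> 'N[P]_p%:E[f] <= 'N[P]_p%:E[g].
Proof. by move=> p0 fg; apply: (@le_Lnorm_off_null _ _ _ set0). Qed.

(** Subadditivity is the pointwise triangle inequality followed by Minkowski for the norms, which
    are measurable real functions; homogeneity takes the p-th power of the scalar out of the
    integral. *)
Lemma seminorm_Lp (E : normedModType R) (p : R) : (1 <= p)%R ->
  seminorm_on [set Z : Omega -> E | strongly_measurable Z] (Lp_norm P p).
Proof.
move=> p1; have p0 : (0 < p)%R by apply: lt_le_trans p1.
split => /=.
- exact: strongly_measurableD.
- exact: strongly_measurableZ.
- by move=> Z; apply: Lnorm_ge0.
- move=> X Y mX mY; rewrite /Lp_norm.
  apply: le_trans (minkowski_EFin P (measurable_norm_strongly_measurable mX)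
    (measurable_norm_strongly_measurable mY) p1).
  apply: le_Lnorm => [|w]; first exact: ltW.
  rewrite /= lee_fin normr_id [leRHS]ger0_norm ?addr_ge0 //.
  exact: ler_normD.
- move=> a Z mZ; rewrite /Lp_norm unlock.
  under eq_integral do rewrite /enorm /= normrZ normrM !normr_id powRM // EFinM.
  under [in RHS]eq_integral do rewrite /enorm /= normr_id.
  rewrite ge0_integralZl_EFin ?powR_ge0 //.
  + rewrite poweRM ?lee_fin ?powR_ge0 //; last first.
      by apply: integral_ge0 => w _; rewrite lee_fin powR_ge0.
    by rewrite poweR_EFin -powRrM divff ?gt_eqF // powRr1.
  + apply/measurable_EFinP.
    apply: (measurableT_comp (measurable_powR p)).
    exact: measurable_norm_strongly_measurable.
Qed.
End Lp.

(** * Continuous paths and modifications *)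

Section PathsAndModifications.
Context {R : realType}.

Lemma eq_holder_norm (V : lmodType R) (N : V -> \bar R) (r T : R)
    (f g : R -> V) : (forall t, 0 <= t <= T -> f t = g t) ->
  holder_norm N r T f = holder_norm N r T g.
Proof.
move=> fg; rewrite /holder_norm /holder_seminorm.
congr (nneg_sup _ + nneg_sup _)%E; apply/seteqP; split.
- by move=> _ [t tT <-]; exists t => //; rewrite fg //; move: tT; rewrite /= in_itv.
- by move=> _ [t tT <-]; exists t => //; rewrite fg //; move: tT; rewrite /= in_itv.
- by move=> _ [s [t [sT tT st ->]]]; exists s, t; split => //; rewrite !fg.
- by move=> _ [s [t [sT tT st ->]]]; exists s, t; split => //; rewrite !fg.
Qed.

(** Every interpolant is Lipschitz, by [lin_interp_lipschitz] with a bound [K] for the finitely many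
    values at knots. *)
Lemma within_continuous_lin_interp (E : normedModType R) (T : R)
    (theta : {fset R}) (f : R -> E) : 0 < T -> is_partition T theta ->
  {within `[0, T], continuous (lin_interp theta f)}.
Proof.
move=> T0 hth; apply/subspace_continuousP => x; rewrite /= in_itv /= => xT.
pose K := \big[Order.max/0]_(u <- enum_fset theta) `|f u|.
have fK u : u \in theta -> (enorm (f u) <= K%:E)%E.
  move=> uth; rewrite lee_fin.
  exact: (le_bigmax_seq 0 u xpredT (fun u => `|f u|) uth isT).
have K0 : 0 <= K by apply: bigmax_ge_id.
have L0 : 0 <= 2 * K / d_min theta.
  by apply: divr_ge0; [exact: mulr_ge0|apply: ltW; exact: (d_min_gt0 T0 hth)].
apply/cvgrPdist_le => e e0; apply/nbhs_ballP.
(* The added 1 covers a Lipschitz constant equal to 0. *)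
have L1 : 0 < 2 * K / d_min theta + 1 by rewrite ltr_wpDl.
exists (e / (2 * K / d_min theta + 1)); first exact: divr_gt0.
move=> t /ltW xt; rewrite /= in_itv /= => tT.
have := lin_interp_lipschitz T0 hth (seminorm_enorm E) (fun _ _ => I) fK tT xT.
rewrite lee_fin => /le_trans; apply.
apply: le_trans (ler_wpM2l L0 xt) _.
by rewrite mulrCA ger_pMr // ler_pdivrMr // mul1r lerDl.
Qed.

Lemma within_continuous_eq_rat (E : normedModType R) (T : R) (f g : R -> E) :
  0 < T -> {within `[0, T], continuous f} -> {within `[0, T], continuous g} ->
  (forall q : rat, 0 <= (ratr q : R) <= T -> f (ratr q) = g (ratr q)) ->
  forall t, 0 <= t <= T -> f t = g t.
Proof.
move=> T0 cf cg fgq t tT; apply/eqP; rewrite -subr_eq0; apply: contraT => fgt.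
have e0 : 0 < `|f t - g t| by rewrite normr_gt0.
have /subspace_continuousP/(_ t) := within_continuousB cf cg.
rewrite /= in_itv => /(_ tT) /cvgrPdist_lt /(_ _ e0) /nbhs_ballP[r /= r0 hr].
case/andP: tT => t0 tT.
(* Even if [t] is an end of the interval, the ball around [t] meets the open interval from 0 to [T],
   which provides a rational. *)
have : Order.max 0 (t - r) < Order.min T (t + r).
  by rewrite gt_max !lt_min T0 /=; lra.
move=> /rat_in_itvoo[q]; rewrite in_itv /= gt_max lt_min -!andbA.
move=> /and4P[q0 qr qT qr'].
have qT' : 0 <= (ratr q : R) <= T by rewrite !ltW.
suff : `|(f t - g t) - (f (ratr q) - g (ratr q))| < `|f t - g t|.
  by rewrite (fgq q qT') subrr subr0 ltxx.
apply: (hr (ratr q)); last by rewrite /= in_itv.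
by rewrite /ball /= ltr_distlC qr.
Qed.

(** Operations on [Omega -> E] are pointwise, so a process is interpolated as a function with values
    in this module, where the seminorm results apply. *)
Lemma path_interpE {d : measure_display} {Omega : measurableType d}
    (E : normedModType R) (theta : {fset R}) (Y : R -> Omega -> E) :
  path_interp theta Y = lin_interp theta Y.
Proof. by apply/funext => t; apply/funext => w. Qed.

Section Modification.
Context {d : measure_display} {Omega : measurableType d}.
Context (P : probability Omega R).
Context {E : normedModType R} {T : R}.
Implicit Types X Y : R -> Omega -> E.

(** The event is the zero set of the norm of [Z - W], a measurable real function. *)
Lemma measurable_strongly_measurable_eq (Z W : Omega -> E) :
  strongly_measurable Z -> strongly_measurable W ->
  measurable [set w | Z w = W w].
Proof.
move=> mZ mW; have mB : strongly_measurable (Z - W).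
  rewrite -scaleN1r.
  exact: strongly_measurableD mZ (strongly_measurableZ _ mW).
rewrite (_ : [set _ | _] = (fun w => `|(Z - W) w|) @^-1` [set 0]).
  rewrite -[X in measurable X]setTI.
  exact: (measurable_norm_strongly_measurable mB).
apply/seteqP; split => w /=.
  by rewrite !fctE => ->; rewrite subrr normr0.
by move/eqP; rewrite normr_eq0 !fctE subr_eq0 => /eqP.
Qed.

Lemma null_strongly_measurable_neq (Z W : Omega -> E) :
  strongly_measurable Z -> strongly_measurable W ->
  P [set w | Z w = W w] = 1%E ->
  measurable (~` [set w | Z w = W w]) /\ P (~` [set w | Z w = W w]) = 0%E.
Proof.
move=> mZ mW PZW; have mA := measurable_strongly_measurable_eq mZ mW.
by split; [exact: measurableC|rewrite probability_setC // PZW subee].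
Qed.

(** At each rational time in [[0, T]] the processes agree off a null set. The union of these
    countably many sets is negligible, and continuity extends the agreement to all times. *)
Lemma modification_indistinguishable X Y : 0 < T ->
  strongly_measurable_process T X -> strongly_measurable_process T Y ->
  continuous_paths T X -> continuous_paths T Y ->
  (forall t, 0 <= t <= T -> P [set w | X t w = Y t w] = 1%E) ->
  exists A : set Omega, [/\ measurable A, P A = 0%E &
    forall w, ~ A w -> forall t, 0 <= t <= T -> X t w = Y t w].
Proof.
move=> T0 mX mY cX cY XY.
(* An enumeration of the rationals, with value 0 at codes of no rational; times outside [[0, T]]
   contribute the empty set to [F]. *)
pose q n : rat := odflt 0 (choice.unpickle n).
pose D (t : R) : set Omega := ~` [set w | X t w = Y t w].
pose F n := if 0 <= (ratr (q n) : R) <= T then D (ratr (q n)) else set0.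
have : P.-negligible (\bigcup_n F n).
  apply: negligible_bigcup => n; rewrite /F.
  case: ifPn => [qT|_]; last exact: negligible_set0.
  have [mN PN] := null_strongly_measurable_neq (mX _ qT) (mY _ qT) (XY _ qT).
  by exists (D (ratr (q n))); split; last exact: subset_refl.
move=> [A [mA PA FA]]; exists A; split => // w nAw.
apply: (within_continuous_eq_rat T0 (cX w) (cY w)) => r rT.
apply: contrapT => neq; apply/nAw/FA; exists (choice.pickle r) => //.
by rewrite /F /q choice.pickleK /= rT.
Qed.

End Modification.
End PathsAndModifications.

(** * Transfer of the Kolmogorov-Chentsov bound to continuous processes *)

Section KolmogorovChentsov.
Context {R : realType} {Xi : R -> R -> R -> R -> R}.
Hypothesis hXi : kolmogorov_chentsov_constant Xi.
Context {d : measure_display} {Omega : measurableType d}.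
Context (P : probability Omega R).
Variables (T p alpha beta : R).
Hypotheses (T0 : 0 < T) (p1 : 1 < p) (beta1 : p^-1 < beta <= 1).
Hypothesis alpha0 : 0 <= alpha < beta - p^-1.

(* Tested on the constant process [1]. *)
Lemma kolmogorov_chentsov_constant_gt0 : 0 < Xi T p alpha beta.
Proof.
have p0 : 0 < p by apply: lt_trans p1.
have LE (c : R) : Lp_norm P p (fun _ : Omega => c : R^o) = `|c|%:E.
  rewrite /Lp_norm unlock.
  under eq_integral do rewrite /enorm /= normr_id.
  rewrite integral_cst // [X in (_ * X)%E](_ : _ = 1%E); last first.
    exact: probability_setT.
  rewrite mule1 poweR_EFin -powRrM divff ?gt_eqF //.
  by rewrite powRr1.
pose X (_ : R) (_ : Omega) : R^o := 1.
have mX : strongly_measurable_process T X.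
  by move=> t _; exact: strongly_measurable_cst.
have hX : (holder_norm (Lp_norm P p) beta T X <= 1)%E.
  (* The supremum accounts for 1 and the increments for 0. *)
  rewrite -(addr0 (1 : R)); apply: holder_norm_le => //.
    by move=> t _; rewrite LE normr1.
  move=> s t _ _ _; rewrite mul0r subrr.
  by rewrite [X in Lp_norm P p X](_ : _ = fun=> 0) // LE normr0.
have T0' := ltW T0.
have [|Y [mY cY XY /(_ _ alpha0)[hY _]]] :=
  @hXi _ _ _ T0' p1 beta1 _ _ _ P _ mX.
  exact: le_lt_trans hX (ltry _).
have zT : 0 <= (0 : R) <= T by apply/andP.
have [mN PN] := null_strongly_measurable_neq (mX _ zT) (mY _ zT) (XY _ zT).
(* Almost surely the path of [Y] starts at 1, so its Hoelder norm is at least 1. *)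
have : (1 <= 'N[P]_p%:E [(fun w => holder_norm enorm alpha T (Y ^~ w))])%E.
  have <- : Lp_norm P p (X 0) = 1%E by rewrite LE normr1.
  apply: (le_Lnorm_off_null _ mN PN); first exact: ltW.
  move=> w /contrapT XY0; rewrite !gee0_abs ?holder_norm_ge0 ?lee_fin //=.
  rewrite XY0; apply: le_trans (leeDl _ (nneg_sup_ge0 _)).
  by apply: nneg_sup_ubound; exists 0 => //=; rewrite in_itv.
(* A constant that is at most 0 would force 1 <= 0. *)
move=> h1; rewrite ltNge; apply/negP => Xi0.
have : (1 <= 0 :> \bar R)%E.
  apply: le_trans h1 (le_trans hY _).
  by apply: mule_le0_ge0; [rewrite lee_fin|exact: holder_norm_ge0].
by rewrite lee_fin ler10.
Qed.

(** The modification [W] of [Z] has the same paths on [[0, T]] off a null set, so its bound passes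
    to [Z]. If the norm on the right is infinite, positivity of the constant makes the right side
    [+oo]. *)
Lemma holder_norm_paths_le (E : completeNormedModType R) (Z : R -> Omega -> E) :
  strongly_measurable_process T Z -> continuous_paths T Z ->
  ('N[P]_p%:E [(fun w => holder_norm enorm alpha T (Z ^~ w))]
    <= (Xi T p alpha beta)%:E * holder_norm (Lp_norm P p) beta T Z)%E.
Proof.
move=> mZ cZ; have Xi0 := kolmogorov_chentsov_constant_gt0.
have [->|Zfin] := eqVneq (holder_norm (Lp_norm P p) beta T Z) +oo%E.
  by rewrite gt0_muley ?lte_fin // leey.
have T0' := ltW T0.
have [|W [mW cW ZW /(_ _ alpha0)[hW _]]] :=
  @hXi _ _ _ T0' p1 beta1 _ _ _ P _ mZ.
  by rewrite ltey.
have [A [mA PA AZW]] := modification_indistinguishable T0 mZ mW cZ cW ZW.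
apply: le_trans hW; apply: (le_Lnorm_off_null _ mA PA).
  by rewrite ltW // (lt_trans _ p1).
by move=> w nAw; rewrite (eq_holder_norm _ _ (AZW w nAw)).
Qed.

End KolmogorovChentsov.

(** * Interpolation estimates for stochastic processes *)

Theorem corollary2p9 (R : realType)
  (Xi : R -> R -> R -> R -> R) (hXi : kolmogorov_chentsov_constant Xi)
  (T : R) (hT : 0 < T) (theta : {fset R}) (htheta : is_partition T theta)
  (d : measure_display) (Omega : measurableType d) (P : probability Omega R)
  (E : completeNormedModType R) :
  (forall (p beta gamma : R),
     1 <= p -> 0 <= beta <= 1 -> beta <= gamma <= 1 ->
   forall X Y : R -> Omega -> E,
     strongly_measurable_process T X -> strongly_measurable_process T Y ->
     (holder_norm (Lp_norm P p) beta T
        (fun t => X t - path_interp theta Y t)%R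
      <= (2 * `|d_max theta| `^ (1 - beta) / d_min theta + 1)%:E
           * nneg_sup [set Lp_norm P p (X t - Y t)%R | t in [set` theta]]
         + ((2 * `|d_max theta| `^ (- beta) + 2 `^ (- gamma))
              * `|d_max theta| `^ gamma)%:E
           * holder_seminorm (Lp_norm P p) gamma T X)%E)
  /\
  (forall (p beta alpha gamma : R),
     1 < p -> p^-1 < beta <= 1 -> 0 <= alpha < beta - p^-1 ->
     beta <= gamma <= 1 ->
   forall X Y : R -> Omega -> E,
     strongly_measurable_process T X -> strongly_measurable_process T Y ->
     continuous_paths T X -> continuous_paths T Y ->
     ('N[P]_p%:E [(fun w => holder_norm enorm alpha T
                    (fun t => X t w - path_interp theta Y t w)%R)]
      <= (Xi T p alpha beta)%:E *
         ((2 * `|d_max theta| `^ (1 - beta) / d_min theta + 1)%:E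
            * nneg_sup [set Lp_norm P p (X t - Y t)%R | t in [set` theta]]
          + ((2 * `|d_max theta| `^ (- beta) + 2 `^ (- gamma))
               * `|d_max theta| `^ gamma)%:E
            * holder_seminorm (Lp_norm P p) gamma T X))%E).
Proof.
have mPath (Y : R -> Omega -> E) : strongly_measurable_process T Y ->
    strongly_measurable_process T (path_interp theta Y).
  move=> mY t tT; rewrite path_interpE.
  (* The seminorm serves here through its domain, the strongly measurable maps, which is the same
     for every exponent. *)
  have S := seminorm_Lp P E (lexx (1 : R)).
  apply: (lin_interp_dom hT htheta S) tT => u uth.
  by apply: mY; exact: (mem_partition_itv htheta).
split=> [p beta gamma p1 b01 bg1 X Y mX mY|].
  rewrite path_interpE.
  exact: (holder_norm_sub_lin_interp hT htheta (seminorm_Lp P E p1)).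
move=> p beta alpha gamma p1 beta1 alpha0 bg1 X Y mX mY cX cY.
have p0 : 0 < p by apply: lt_trans p1.
have b01 : 0 <= beta <= 1.
  by case/andP: beta1 => /ltW pb ->; rewrite (le_trans _ pb) // invr_ge0 ltW.
pose Z t := X t - path_interp theta Y t.
have mZ : strongly_measurable_process T Z.
  move=> t tT; apply: (seminorm_domB (seminorm_Lp P E (lexx 1))).
    exact: mX.
  exact: mPath.
have cZ : continuous_paths T Z.
  move=> w; apply: within_continuousB; first exact: cX.
  exact: within_continuous_lin_interp.
(* The pathwise norm of [Z] is bounded by its L^p Hoelder norm, to which the estimate of the first
   half applies; the constant is positive, so the product is monotone. *)
have := holder_norm_paths_le hXi P hT p1 beta1 alpha0 mZ cZ.
move=> /le_trans; apply; apply: lee_wpmul2l.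
  by rewrite lee_fin ltW // (kolmogorov_chentsov_constant_gt0 hXi P).
rewrite /Z path_interpE.
exact: (holder_norm_sub_lin_interp hT htheta (seminorm_Lp P E (ltW p1))).
Qed.
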